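(* Let $n\in\mathbb N$, let $\Xi_n,\Lambda_n\in\mathbb Q[x]$ be the even polynomials defined in the context, and define the Eulerian polynomials of type $B$ and type $A$ by $$B_{m}(z):=\sum_{k=0}^{m}\left\langle{m\atop k}\right\rangle^{B}z^k,\qquad A_{m}(z):=\sum_{k=0}^{m-1}\left\langle{m\atop k}\right\rangle z^k .$$ Then, for every $x\in\mathbb C\setminus\{0,-1\}$, $$\Xi_n(x)=\frac{(-1)^{n+1}}{2^{4n-1}(2n-1)!}\,\frac{(1+x)^{2n-1}}{x}\,B_{2n-1}\!\left(-\frac{1-x}{1+x}\right),$$ $$\Lambda_n(x)=\frac{(-1)^{n+1}}{(2^{2n+1}-1)(2n)!}\,\frac{(1+x)^{2n-1}}{x}\,A_{2n}\!\left(-\frac{1-x}{1+x}\right).$$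
   Context: $\mathbb N=\{1,2,3,\dots\}$. Binomial coefficients satisfy $\binom{m}{\ell}=0$ whenever $\ell<0$ or $\ell>m$. The Eulerian number of type $A$, $\left\langle{m\atop k}\right\rangle$ ($m\ge1$, $0\le k\le m-1$), is the number of permutations of $\{1,\dots,m\}$ with exactly $k$ descents; equivalently $\sum_{j\ge0}(j+1)^m x^j=(1-x)^{-m-1}\sum_{k=0}^{m-1}\left\langle{m\atop k}\right\rangle x^k$ for $|x|<1$. The Eulerian number of type $B$, $\left\langle{m\atop k}\right\rangle^{B}$ ($m\ge0$, $0\le k\le m$), is determined by $\sum_{j\ge0}(2j+1)^m x^j=(1-x)^{-m-1}\sum_{k=0}^{m}\left\langle{m\atop k}\right\rangle^{B} x^k$ for $|x|<1$. For $n\in\mathbb N$ and $0\le t\le n-1$ let $$\mathcal C^{(B)}_{n,t}:=\sum_{k=0}^{n-1}\left\langle {2n-1 \atop k}\right\rangle^{B}(-1)^{k}\sum_{i=0}^{k}(-1)^i\binom{k}{i}\binom{2n-2k-1}{2t-2i+1},\quad \mathcal C^{(A)}_{n,t}:=\sum_{k=0}^{n-1}\left\langle {2n \atop k}\right\rangle(-1)^{k}\sum_{i=0}^{k}(-1)^i\binom{k}{i}\binom{2n-2k-1}{2t-2i+1},$$ $$\Xi_n(x):=\frac{(-1)^{n+1}}{2^{4n-2}(2n-1)!}\sum_{t=0}^{n-1}\mathcal C^{(B)}_{n,t}\,x^{2t},\qquad \Lambda_n(x):=\frac{2(-1)^{n+1}}{(2^{2n+1}-1)(2n)!}\sum_{t=0}^{n-1}\mathcal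 C^{(A)}_{n,t}\,x^{2t}.$$ *)

(* Defs.v *)
From mathcomp Require Import all_boot all_order all_algebra all_fingroup.
From mathcomp Require Import complex zify ring.
From mathcomp Require Import all_classical all_reals all_analysis.

Set Implicit Arguments.
Unset Strict Implicit.
Unset Printing Implicit Defensive.

Import Order.TTheory GRing.Theory Num.Theory.
Import numFieldNormedType.Exports.

Local Open Scope classical_set_scope.
Local Open Scope ring_scope.

Definition descents (m : nat) (s : 'S_m) : nat :=
  #|[set ij : 'I_m * 'I_m | (ij.2 == ij.1.+1 :> nat) && (s ij.2 < s ij.1)%N]%SET|.

Definition eulerianA (m k : nat) : nat := #|[set s : 'S_m | descents s == k]%SET|.

(* The first conjunct only makes [a] unique as a function on all of [nat]. *)
Definition is_eulerianB (R : realType) (m : nat) (a : nat -> nat) : Prop :=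
  (forall k, (m < k)%N -> a k = 0%N) /\
  (forall x : R, `|x| < 1 ->
    series (fun j => (2 * j + 1)%:R ^+ m * x ^+ j) @ \oo -->
      (1 - x) ^- m.+1 * \sum_(k < m.+1) (a k)%:R * x ^+ k).

(* A witness for the existence of the type B Eulerian numbers. *)
Fixpoint eulerianB_rec (m k : nat) : nat :=
  match m, k with
  | 0, 0 => 1
  | 0, _.+1 => 0
  | m'.+1, 0 => eulerianB_rec m' 0
  | m'.+1, k'.+1 => (2 * k + 1) * eulerianB_rec m' k
                    + (2 * (m' - k') + 1) * eulerianB_rec m' k'
  end%N.

Lemma eulerianB_rec_gt m k : (m < k)%N -> eulerianB_rec m k = 0%N.
Proof.
elim: m k => [|m IH] [|k] //= hk.
by rewrite !IH ?muln0 // ltnW.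
Qed.

Lemma bin_step m u k : (k <= m)%N ->
  ((2 * (u - m) + 2 * k + 1) * 'C(u, m) =
   (2 * k + 1) * 'C(u.+1, m.+1) + (2 * (m - k) + 1) * 'C(u, m.+1))%N.
Proof.
move=> hk; rewrite binS.
have := mul_bin_left u m; have [hu|hu] := leqP m u; last first.
  by rewrite (bin_small hu) bin_small ?muln0 // ltnS ltnW.
move: 'C(u, m.+1) 'C(u, m) => A B.
have [d ->] : exists d, u = (m + d)%N by exists (u - m)%N; lia.
have [e ->] : exists e, m = (k + e)%N by exists (m - k)%N; lia.
rewrite !(addKn) => H; nia.
Qed.

Lemma eulerianB_worpitzky m j :
  ((2 * j + 1) ^ m = \sum_(k < m.+1) eulerianB_rec m k * 'C(m + j - k, m))%N.
Proof.
elim: m => [|m IH]; first by rewrite big_ord1 /= bin0.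
have -> : (\sum_(k < m.+2) eulerianB_rec m.+1 k * 'C(m.+1 + j - k, m.+1) =
  \sum_(k < m.+1) (2 * k + 1) * eulerianB_rec m k * 'C(m.+1 + j - k, m.+1) +
  \sum_(k < m.+1) (2 * (m - k) + 1) * eulerianB_rec m k * 'C(m + j - k, m.+1))%N.
  rewrite big_ord_recl [X in _ = (X + _)%N]big_ord_recl /= muln0 mul1n.
  rewrite -addnA; congr addn.
  under eq_bigr do rewrite /bump /= add1n mulnDl addSn subSS.
  rewrite big_split /=; congr addn; rewrite big_ord_recr /=.
  rewrite eulerianB_rec_gt // muln0 mul0n addn0.
  by apply: eq_bigr => i _; rewrite /bump /= add1n addSn subSS.
rewrite -big_split /= expnSr IH big_distrl /=; apply: eq_bigr => k _.
have [hkj|hkj] := leqP k j; last first.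
  rewrite !bin_small ?muln0 //; have := ltn_ord k; lia.
have hkm : (k <= m)%N by rewrite -ltnS.
have := bin_step (m + j - k) hkm.
have -> : (2 * (m + j - k - m) + 2 * k + 1 = 2 * j + 1)%N by lia.
have -> : (m.+1 + j - k = (m + j - k).+1)%N by lia.
move: 'C(_, m.+1) 'C(_.+1, m.+1) 'C(_, m) => *; nia.
Qed.

Section GeneratingFunction.
Variable R : realType.
Implicit Types x : R.

Let u m x : nat -> R := fun j => 'C(m + j, m)%:R * x ^+ j.

Let u_step m x N :
  (1 - x) * series (u m.+1 x) N + u m.+1 x N =
  series (u m x) N.+1.
Proof.
rewrite /series /=; elim: N => [|N IH].
  by rewrite big_geq // big_nat1 /u !addn0 !binn; ring.
rewrite big_nat_recr //= [in RHS]big_nat_recr //= -IH /u.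
have -> : 'C(m.+1 + N.+1, m.+1)%:R =
          'C(m.+1 + N, m.+1)%:R + 'C(m + N.+1, m)%:R :> R.
  by rewrite -natrD addSn binS addnS addSn.
rewrite exprS; ring.
Qed.

Let u_bound m x : 0 <= x -> x < 1 -> forall N,
  series (u m x) N <= (1 - x) ^- m.+1.
Proof.
move=> x0 x1; have x1' : 0 < 1 - x by rewrite subr_gt0.
elim: m => [|m IH] N.
  have -> : series (u 0 x) N = series (geometric 1 x) N.
    rewrite /series /=; apply: eq_bigr => i _.
    by rewrite /u /geometric /= bin0.
  rewrite geometric_seriesE ?lt_eqF //.
  rewrite expr1 /= mul1r ler_pdivrMr // mulVf ?gt_eqF //.
  by rewrite gerBl exprn_ge0.
rewrite exprS invfM -(ler_pM2l x1') mulrA divff ?gt_eqF // mul1r.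
apply: le_trans (IH N.+1); rewrite -u_step lerDl.
by rewrite /u mulr_ge0 // exprn_ge0.
Qed.

Let u_cvg0 m x : `|x| < 1 -> u m x @ \oo --> (0 : R).
Proof.
move=> x1.
suff H : u m `|x| @ \oo --> (0 : R).
  apply/norm_cvg0P; apply: cvg_trans H; apply: near_eq_cvg; near=> N.
  by rewrite /u normrM normrX normr_nat.
apply: cvg_series_cvg_0; apply: nondecreasing_is_cvgn.
  by apply: nondecreasing_series => i _ _; rewrite /u mulr_ge0 // exprn_ge0.
exists ((1 - `|x|) ^- m.+1) => _ [N _ <-]; exact: u_bound.
Unshelve. all: by end_near.
Qed.

Let u_series m x : `|x| < 1 ->
  series (u m x) @ \oo --> ((1 - x) ^- m.+1 : R).
Proof.
move=> x1; have x1' : 1 - x != 0.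
  by rewrite subr_eq0; apply/eqP => xE; move: x1; rewrite -xE normr1 ltxx.
elim: m => [|m IH].
  have -> : series (u 0 x) = series (geometric 1 x).
    apply/funext => N; rewrite /series /=; apply: eq_bigr => i _.
    by rewrite /u /geometric /= bin0.
  by rewrite expr1 -[_^-1]mul1r; exact: cvg_geometric_series.
have -> : series (u m.+1 x) =
  (fun N => (1 - x)^-1 * (series (u m x) N.+1 - u m.+1 x N)).
  apply/funext => N; rewrite -u_step addrK mulrA mulVf //.
  by rewrite mul1r.
rewrite (_ : (1 - x) ^- m.+2 = (1 - x)^-1 * ((1 - x) ^- m.+1 - 0)); last first.
  by rewrite subr0 exprS invfM.
apply: cvgMr; apply: cvgB; last exact: u_cvg0.
by move: IH; rewrite -(cvg_shiftS (series (u m x))).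
Qed.

Let u_shift m k x : (k <= m)%N -> `|x| < 1 ->
  series (fun j => 'C(m + j - k, m)%:R * x ^+ j) @ \oo -->
  ((1 - x) ^- m.+1 * x ^+ k : R).
Proof.
move=> km x1; rewrite -(cvg_shiftn k) /=.
have -> : (fun N => series (fun j => 'C(m + j - k, m)%:R * x ^+ j) (N + k)%N)
  = (fun N => series (u m x) N * x ^+ k).
  apply/funext => N; rewrite /series /= addnC.
  rewrite (@big_cat_nat _ _ _ k) ?leq_addr //= big_nat big1 ?add0r; last first.
    move=> i /andP[_ ik]; rewrite bin_small ?mul0r //; lia.
  rewrite -{1}[k]add0n big_addn addKn mulr_suml; apply: eq_bigr => i _.
  by rewrite /u exprD mulrA addnA addnK.
by apply: cvgMl; exact: u_series.
Qed.

Lemma eulerianB_recP m : is_eulerianB R m (eulerianB_rec m).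
Proof.
split=> [k|x x1]; first exact: eulerianB_rec_gt.
have -> : series (fun j => (2 * j + 1)%:R ^+ m * x ^+ j) =
  (fun N => \sum_(k < m.+1) (eulerianB_rec m k)%:R *
     series (fun j => 'C(m + j - k, m)%:R * x ^+ j) N).
  apply/funext => N; rewrite /series /=.
  under [RHS]eq_bigr do rewrite mulr_sumr.
  rewrite exchange_big /=; apply: eq_bigr => j _.
  rewrite -natrX eulerianB_worpitzky natr_sum mulr_suml.
  by apply: eq_bigr => k _; rewrite natrM mulrA.
rewrite mulr_sumr; apply: cvg_big => [|k _]; first exact: add_continuous.
by rewrite mulrCA; apply: cvgMr; apply: u_shift; rewrite // -ltnS.
Qed.

Lemma is_eulerianB_uniq m a b :
  is_eulerianB R m a -> is_eulerianB R m b -> a = b.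
Proof.
move=> [a0 ha] [b0 hb].
pose P c : {poly R} := \poly_(k < m.+1) (c k)%:R.
have PE c x : (P c).[x] = \sum_(k < m.+1) (c k)%:R * x ^+ k.
  by rewrite horner_poly.
have key x : `|x| < 1 -> (P a).[x] = (P b).[x].
  move=> x1; rewrite !PE.
  have x1' : (1 - x) ^- m.+1 != 0.
    rewrite invr_eq0 expf_neq0 // subr_eq0.
    by apply/eqP => xE; move: x1; rewrite -xE normr1 ltxx.
  apply: (mulfI x1').
  by apply: (cvg_unique _ (ha x x1) (hb x x1)).
have PQ : P a = P b.
  apply/eqP; rewrite -subr_eq0; apply/eqP.
  pose s := [seq (i.+2%:R : R)^-1 | i <- iota 0 m.+1].
  apply: (@roots_geq_poly_eq0 _ _ s).
  - apply/allP => _ /mapP[i _ ->]; rewrite rootE hornerD hornerN key ?subrr //.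
    by rewrite ger0_norm // invf_lt1 // ltr1n.
  - rewrite map_inj_uniq ?iota_uniq // => i j /invr_inj /eqP.
    by rewrite eqr_nat => /eqP [].
  - rewrite size_map size_iota (leq_trans (size_polyD _ _)) //.
    by rewrite size_polyN geq_max !size_poly.
apply/funext => k; have [km|mk] := leqP k m; last by rewrite a0 // b0.
have := congr1 (fun p : {poly R} => p`_k) PQ.
by rewrite !coef_poly ltnS km => /eqP; rewrite eqr_nat => /eqP.
Qed.

End GeneratingFunction.

Lemma eulerianB_ex (R : realType) (m : nat) : exists a, is_eulerianB R m a.
Proof. by exists (eulerianB_rec m); exact: eulerianB_recP. Qed.

(* The numbers determined by the generating function; they are unique by
   [is_eulerianB_uniq], so the choice made by [cid] is immaterial. *)
Definition eulerianB (R : realType) (m : nat) : nat -> nat :=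
  sval (cid (eulerianB_ex R m)).

Lemma eulerianBP (R : realType) (m : nat) : is_eulerianB R m (eulerianB R m).
Proof. exact: svalP (cid (eulerianB_ex R m)). Qed.

(* Binomial coefficient with an integer lower index, 0 when it is negative. *)
Definition binz (m : nat) (l : int) : nat :=
  if l is Posz l' then 'C(m, l') else 0%N.

Definition coefC (E : nat -> nat) (n t : nat) : int :=
  \sum_(0 <= k < n) (E k)%:Z * (-1) ^+ k *
    \sum_(0 <= i < k.+1) (-1) ^+ i * ('C(k, i))%:Z *
       (binz (2 * n - 2 * k - 1) (2 * t%:Z - 2 * i%:Z + 1))%:Z.

Definition coefCB (R : realType) (n t : nat) : int :=
  coefC (eulerianB R (2 * n - 1)) n t.

Definition coefCA (n t : nat) : int := coefC (eulerianA (2 * n)) n t.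

Definition Xi (R : realType) (n : nat) : {poly rat} :=
  ((-1) ^+ n.+1 / (2 ^+ (4 * n - 2) * ((2 * n - 1)`!)%:R)) *:
    \sum_(0 <= t < n) (coefCB R n t)%:~R *: 'X^(2 * t).

Definition Lambda (n : nat) : {poly rat} :=
  (2 * (-1) ^+ n.+1 / ((2 ^+ (2 * n + 1) - 1) * ((2 * n)`!)%:R)) *:
    \sum_(0 <= t < n) (coefCA n t)%:~R *: 'X^(2 * t).

Definition polyB (R : realType) (m : nat) : {poly rat} :=
  \sum_(0 <= k < m.+1) (eulerianB R m k)%:R *: 'X^k.

Definition polyA (m : nat) : {poly rat} :=
  \sum_(0 <= k < m) (eulerianA m k)%:R *: 'X^k.

Definition evalC (R : realType) (p : {poly rat}) (x : R[i]) : R[i] :=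
  (map_poly ratr p).[x].

(* Main.v *)
Require Import Defs.
From mathcomp Require Import all_boot all_order all_algebra.
From mathcomp Require Import complex reals.
From mathcomp Require Import all_fingroup zify ring.

Import GRing.Theory Num.Theory.
Local Open Scope ring_scope.

(** Clearing denominators turns (1+x)^N E(-(1-x)/(1+x)), for N = 2n-1 and an
    Eulerian polynomial E(z) = sum_(k <= N) E_k z^k, into the homogeneous form
    sum_(k <= N) (-1)^k E_k (1-x)^k (1+x)^(N-k).  The Eulerian numbers are
    palindromic, E_k = E_(N-k) ([eulerianB_rec_sym], [eulerianA_sym]), and N is
    odd, so the terms k and N-k combine, for k < n, into
      (-1)^k E_k (1-x^2)^k ((1+x)^(N-2k) - (1-x)^(N-2k)).
    The last difference is twice the odd part of (1+x)^(N-2k).  Expanding both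
    factors by the binomial theorem, the coefficient of 2 x^(2t+1) is exactly
    the inner alternating sum in the definition of [Defs.coefC] ([inner_sumE]).
    Hence the homogeneous form equals 2x times the sum over t of
    ([Defs.coefC] E n t) x^(2t) ([sum_coefC]); the factor 2 accounts for
    the discrepancy between the constants on the two sides. *)

(** * Palindromicity of the Eulerian numbers *)

(** The weights 2k+1 and 2(m-k)+1 in the type B recursion are exchanged by
    k -> m - k, so symmetry propagates from each row to the next. *)
Lemma eulerianB_rec_sym m k : (k <= m)%N ->
  eulerianB_rec m (m - k) = eulerianB_rec m k.
Proof.
have diag p : eulerianB_rec p p = 1%N.
  by elim: p => //= p ->; rewrite eulerianB_rec_gt // subnn muln0.
have zero p : eulerianB_rec p 0 = 1%N by elim: p.
elim: m k => [|m IH] [|k] // hk; first by rewrite subn0 diag zero.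
rewrite subSS; have [km|mk|->] := ltngtP k m; [|lia|by rewrite subnn diag zero].
have /= -> : (m - k = (m - k.+1).+1)%N by lia.
rewrite -subSn // subSS (IH _ km) (IH k (ltnW km)).
have -> : (m - (m - k.+1) = k.+1)%N by lia.
by rewrite addnC.
Qed.

Lemma eulerianB_sym (R : realType) m k : (k <= m)%N ->
  eulerianB R m (m - k) = eulerianB R m k.
Proof.
have -> : eulerianB R m = eulerianB_rec m.
  exact: is_eulerianB_uniq (eulerianBP R m) (eulerianB_recP R m).
exact: eulerianB_rec_sym.
Qed.

Lemma card_adjacent m :
  #|[set ij : 'I_m.+1 * 'I_m.+1 | ij.2 == ij.1.+1 :> nat]| = m.
Proof.
pose f (i : 'I_m) : 'I_m.+1 * 'I_m.+1 := (widen_ord (leqnSn m) i, lift ord0 i).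
have f_inj : injective f by move=> i j [/= ij _]; apply/val_inj.
rewrite -[RHS]card_ord -(card_imset _ f_inj); apply: eq_card => -[i j].
rewrite inE /=; apply/eqP/imsetP => [ji|[k _ [-> ->]]] //=.
have im : (i < m)%N by rewrite -ltnS -ji.
by exists (Ordinal im) => //; congr (_, _); apply/val_inj => //=; rewrite ji.
Qed.

Definition rev_perm m : 'S_m := perm (@rev_ord_inj m).

(** Reversing the values of a permutation exchanges its descents and its
    ascents, and these together exhaust the m adjacent positions. *)
Lemma descents_rev m (s : 'S_m.+1) :
  (descents (s * rev_perm _)%g + descents s = m)%N.
Proof.
rewrite -[RHS]card_adjacent /descents.
rewrite -(cardsID [set ij : 'I_m.+1 * 'I_m.+1 | (s ij.2 < s ij.1)%N]
  [set ij : 'I_m.+1 * 'I_m.+1 | ij.2 == ij.1.+1 :> nat]) addnC; congr addn.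
  by apply: eq_card => -[i j]; rewrite !inE.
apply: eq_card => -[i j]; rewrite !inE /= !permM !permE /= andbC.
have [ji|] := eqVneq (j : nat) i.+1; last by rewrite !andbF.
rewrite !andbT; have : s i != s j :> nat.
  apply/eqP => /val_inj/perm_inj ij; move: ji; rewrite ij => ji; lia.
have := ltn_ord (s i); have := ltn_ord (s j); lia.
Qed.

Lemma eulerianA_sym m k : (k <= m)%N ->
  eulerianA m.+1 (m - k) = eulerianA m.+1 k.
Proof.
move=> km; rewrite /eulerianA.
rewrite -[RHS](card_preimset _ (mulIg (rev_perm m.+1))).
apply: eq_card => s; rewrite !inE.
have revE := canRL (addnK _) (descents_rev m s).
have le_s := leq_trans (leq_addl _ _) (eq_leq (descents_rev m s)).
by rewrite revE; apply/eqP/eqP => [->|<-]; rewrite subKn.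
Qed.

(** * The homogenized Eulerian polynomial *)

Section OddPart.
Variable F : comNzRingType.
Implicit Type x : F.

Lemma sum_even_odd (f : nat -> F) r :
  \sum_(0 <= j < 2 * r) f j = \sum_(0 <= j < r) (f (2 * j)%N + f (2 * j + 1)%N).
Proof.
elim: r => [|r IH]; first by rewrite !big_geq.
have -> : (2 * r.+1 = (2 * r).+2)%N by lia.
by rewrite !big_nat_recr //= IH addn1 addrA.
Qed.

(** The range is left free above the degree because the sum is used with
    several bounds for the same exponent. *)
Lemma odd_part M r x : (M < 2 * r)%N ->
  (1 + x) ^+ M - (1 - x) ^+ M =
  2 * \sum_(0 <= j < r) 'C(M, 2 * j + 1)%:R * x ^+ (2 * j + 1).
Proof.
move=> Mr.
have expand (y : F) : (1 + y) ^+ M = \sum_(0 <= j < 2 * r) 'C(M, j)%:R * y ^+ j.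
  rewrite exprDn.
  rewrite -(big_mkord xpredT (fun i => (1 ^+ (M - i) * y ^+ i) *+ 'C(M, i))).
  rewrite [RHS](@big_cat_nat _ _ _ M.+1) //= [X in _ = _ + X]big_nat.
  rewrite [X in _ = _ + X]big1 ?addr0; last first.
    by move=> i /andP[Mi _]; rewrite bin_small ?mul0r.
  by apply: eq_bigr => i _; rewrite expr1n mul1r mulr_natl.
rewrite !expand -sumrB sum_even_odd mulr_sumr; apply: eq_bigr => j _.
have sign_even : (-1) ^+ (2 * j) = 1 :> F by rewrite exprM sqrrN !expr1n.
by rewrite !(exprNn x) !(exprD _ (2 * j) 1) sign_even; ring.
Qed.

(** Substitute t = i + j: a term with t < i has a negative lower index, and the
    bound on M ensures that cutting the sum at n loses no odd power. *)
Lemma sum_binz_shift M n i x : (i <= n)%N -> (M < 2 * (n - i))%N ->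
  2 * x * \sum_(0 <= t < n) (binz M (2 * t%:Z - 2 * i%:Z + 1))%:R * x ^+ (2 * t)
  = x ^+ (2 * i) * ((1 + x) ^+ M - (1 - x) ^+ M).
Proof.
move=> iln Mn; rewrite (@odd_part M (n - i)) // (@big_cat_nat _ _ _ i) //=.
rewrite big_nat big1 ?add0r; last first.
  move=> t /andP[_ ti].
  have -> : 2 * t%:Z - 2 * i%:Z + 1 = Negz (2 * (i - t.+1)) by lia.
  by rewrite mul0r.
rewrite -{1}(add0n i) big_addn !mulr_sumr.
apply: eq_bigr => j _.
have -> : 2 * (j + i)%N%:Z - 2 * i%:Z + 1 = (2 * j + 1)%N%:Z by lia.
by rewrite /= mulnDr !(exprD x (2 * j)); ring.
Qed.

Lemma inner_sumE n k x : (k < n)%N ->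
  2 * x * \sum_(0 <= t < n) (\sum_(0 <= i < k.+1) (-1) ^+ i * 'C(k, i)%:R *
      (binz (2 * n - 2 * k - 1) (2 * t%:Z - 2 * i%:Z + 1))%:R) * x ^+ (2 * t)
  = (1 - x ^+ 2) ^+ k *
    ((1 + x) ^+ (2 * n - 2 * k - 1) - (1 - x) ^+ (2 * n - 2 * k - 1)).
Proof.
move=> kn; set M := (2 * n - 2 * k - 1)%N.
under eq_bigr do rewrite mulr_suml.
rewrite exchange_big /= exprDn mulr_suml.
rewrite -(big_mkord xpredT (fun i => (1 ^+ (k - i) * (- x ^+ 2) ^+ i) *+ 'C(k, i) *
   ((1 + x) ^+ M - (1 - x) ^+ M))) mulr_sumr.
rewrite !big_nat; apply: eq_bigr => i /andP[_ ik].
under eq_bigr do rewrite -mulrA.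
rewrite -mulr_sumr mulrCA sum_binz_shift ?/M; [|lia|lia].
by rewrite expr1n mul1r (exprNn (x ^+ 2)) (exprM x 2) -mulr_natr; ring.
Qed.

(** Since 2n-1 is odd, the signs (-1)^k and (-1)^(2n-1-k) are opposite, which
    is why palindromic coefficients leave only odd powers of x. *)
Lemma sum_coefC (E : nat -> nat) n x :
  (forall k, (k < n)%N -> E (2 * n - 1 - k)%N = E k) ->
  2 * x * \sum_(0 <= t < n) (Defs.coefC E n t)%:~R * x ^+ (2 * t) =
  \sum_(0 <= k < 2 * n)
     (E k)%:R * (-1) ^+ k * (1 - x) ^+ k * (1 + x) ^+ (2 * n - 1 - k).
Proof.
move=> Esym.
rewrite [RHS](@big_cat_nat _ _ _ n) //=; last by lia.
(* The upper half is reversed so that k and 2n-1-k face each other. *)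
rewrite [X in _ = _ + X]big_nat_rev /= [X in _ = _ + X](big_addn 0).
have -> : (2 * n - n = n)%N by lia.
rewrite -big_split /=.
have coefE t : (Defs.coefC E n t)%:~R = \sum_(0 <= k < n) (E k)%:R * (-1) ^+ k *
    \sum_(0 <= i < k.+1) (-1) ^+ i * 'C(k, i)%:R *
      (binz (2 * n - 2 * k - 1) (2 * t%:Z - 2 * i%:Z + 1))%:R :> F.
  rewrite /Defs.coefC rmorph_sum; apply: eq_bigr => k _.
  rewrite !rmorphM rmorphXn rmorphN1 rmorph_sum; congr (_ * _).
  by apply: eq_bigr => i _; rewrite !rmorphM rmorphXn rmorphN1.
under eq_bigr do rewrite coefE mulr_suml.
rewrite exchange_big /= mulr_sumr !big_nat; apply: eq_bigr => k /andP[_ kn].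
under eq_bigr do rewrite -[_ * _ * x ^+ _]mulrA.
rewrite -mulr_sumr mulrCA inner_sumE //.
have -> : (n + 2 * n - (k + n).+1 = 2 * n - 1 - k)%N by lia.
rewrite Esym //.
have -> : (2 * n - 1 - (2 * n - 1 - k) = k)%N by lia.
have [d ->] : exists d, n = (k + d).+1 by exists (n - k.+1)%N; lia.
have -> : (2 * (k + d).+1 - 2 * k - 1 = 2 * d + 1)%N by lia.
have -> : (2 * (k + d).+1 - 1 - k = k + (2 * d + 1))%N by lia.
have -> : 1 - x ^+ 2 = (1 - x) * (1 + x) by ring.
have -> : (-1) ^+ (k + (2 * d + 1)) = - (-1) ^+ k :> F.
  by rewrite exprD (exprD _ (2 * d)) exprM sqrrN !expr1n expr1; ring.
by rewrite exprMn !(exprD _ k (2 * d + 1)); ring.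
Qed.

End OddPart.

(** * Back to the Eulerian polynomials *)

Lemma sum_coefC_frac (F : fieldType) (E : nat -> nat) n (x : F) :
  x != 0 -> 1 + x != 0 ->
  (forall k, (k < n)%N -> E (2 * n - 1 - k)%N = E k) ->
  2 * \sum_(0 <= t < n) (Defs.coefC E n t)%:~R * x ^+ (2 * t) =
  (1 + x) ^+ (2 * n - 1) / x *
    \sum_(0 <= k < 2 * n) (E k)%:R * (- ((1 - x) / (1 + x))) ^+ k.
Proof.
move=> x0 x1 Esym; apply: (mulfI x0).
rewrite mulrA [x * 2]mulrC sum_coefC // mulrA mulrCA divff // mulr1 mulr_sumr.
rewrite !big_nat; apply: eq_bigr => k /andP[_ kn].
have -> : (1 + x) ^+ (2 * n - 1) = (1 + x) ^+ (2 * n - 1 - k) * (1 + x) ^+ k.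
  by rewrite -exprD subnK //; lia.
have x1k : (1 + x) ^+ k != 0 by rewrite expf_neq0.
by rewrite (exprNn (_ / _)) expr_div_n; field.
Qed.

Lemma evalCZ (R : realType) c p (x : R[i]) :
  evalC (c *: p) x = ratr c * evalC p x.
Proof. by rewrite /evalC map_polyZ hornerZ. Qed.

Lemma evalC_sum (R : realType) (c : nat -> rat) (d : nat -> nat) m (x : R[i]) :
  evalC (\sum_(0 <= k < m) c k *: 'X^(d k)) x =
  \sum_(0 <= k < m) ratr (c k) * x ^+ d k.
Proof.
rewrite /evalC rmorph_sum horner_sum; apply: eq_bigr => k _.
by rewrite /= map_polyZ map_polyXn hornerZ hornerXn.
Qed.

Theorem proposition4p1 (R : realType) (n : nat) (hn : (1 <= n)%N)
    (x : R[i]) (hx0 : x <> 0) (hx1 : x <> -1) :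
  evalC (Xi R n) x =
    (-1) ^+ n.+1 / (2 ^+ (4 * n - 1) * ((2 * n - 1)`!)%:R) *
    ((1 + x) ^+ (2 * n - 1) / x) *
    evalC (polyB R (2 * n - 1)) (- ((1 - x) / (1 + x)))
  /\
  evalC (Lambda n) x =
    (-1) ^+ n.+1 / ((2 ^+ (2 * n + 1) - 1) * ((2 * n)`!)%:R) *
    ((1 + x) ^+ (2 * n - 1) / x) *
    evalC (polyA (2 * n)) (- ((1 - x) / (1 + x))).
Proof.
have x0 : x != 0 by apply/eqP.
have x1 : 1 + x != 0.
  by apply/eqP => x1; apply: hx1; apply/eqP; rewrite -addr_eq0 addrC x1.
have evalE (E : nat -> nat) y :
    evalC (\sum_(0 <= k < 2 * n) (E k)%:R *: 'X^k) y =
    \sum_(0 <= k < 2 * n) (E k)%:R * y ^+ k :> R[i].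
  by rewrite (evalC_sum R _ id); under eq_bigr do rewrite ratr_nat.
have evalCE (E : nat -> nat) :
    evalC (\sum_(0 <= t < n) (Defs.coefC E n t)%:~R *: 'X^(2 * t)) x =
    \sum_(0 <= t < n) (Defs.coefC E n t)%:~R * x ^+ (2 * t).
  by rewrite evalC_sum; under eq_bigr do rewrite ratr_int.
split.
- rewrite /Xi evalCZ evalCE /polyB.
  have -> : ((2 * n - 1).+1 = 2 * n)%N by lia.
  rewrite evalE -[RHS]mulrA -sum_coefC_frac //; last first.
    by move=> k kn; apply: eulerianB_sym; lia.
  rewrite mulrA; congr (_ * _).
  have -> : (4 * n - 1 = (4 * n - 2).+1)%N by lia.
  rewrite fmorph_div rmorphM !rmorphXn rmorphN1 /= !ratr_nat (exprS 2).
  have f0 : ((2 * n - 1)`!)%:R != 0 :> R[i] by rewrite pnatr_eq0 -lt0n fact_gt0.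
  have p0 : 2 ^+ (4 * n - 2) != 0 :> R[i] by rewrite expf_neq0 // pnatr_eq0.
  by field; rewrite f0 p0.
- rewrite /Lambda evalCZ evalCE /polyA evalE -[RHS]mulrA.
  rewrite -sum_coefC_frac //; last first.
    move=> k kn; have -> : (2 * n = (2 * n - 1).+1)%N by lia.
    by rewrite subSS subn0; apply: eulerianA_sym; lia.
  rewrite mulrA; congr (_ * _).
  rewrite fmorph_div !rmorphM rmorphB !rmorphXn rmorphN1 rmorph1 /= !ratr_nat.
  by rewrite [2 * _]mulrC mulrAC.
Qed.
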